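(* Let $n\ge 2$ and let $\mathcal{S}$ be a numerical semigroup with minimal generating set $A=\{a_1,\ldots,a_n\}$. For $i\in\{1,\ldots,n\}$ let $c_i=\min\{c\in\mathbb{Z}^+\mid c\,a_i\in\langle a_1,\ldots,a_{i-1},a_{i+1},\ldots,a_n\rangle\}$. If $\mathcal{S}$ is universally free, then: (a) $c_i=\gcd(A\setminus\{a_i\})$ for every $i\in\{1,\ldots,n\}$; (b) each Betti degree of $I_A$ is divisible by $c_ka_k$ for some $k\in\{1,\ldots,n\}$; (c) $I_A$ is minimally generated by $n-1$ circuits; (d) $\operatorname{Betti}(A)=\{\operatorname{lcm}(a_i,a_j)\mid i\neq j\}$.
   Context: $\mathbb{K}$ is an arbitrary field and $\mathbb{N}$ contains $0$. For positive integers $a_1,\ldots,a_n$, $\langle a_1,\ldots,a_n\rangle=\{u_1a_1+\cdots+u_na_n\mid u_i\in\mathbb{N}\}$. A numerical semigroup is a submonoid of $\mathbb{N}$ generated by a finite set of positive integers with greatest common divisor $1$; its minimal generating set is its unique generating set no proper subset of which generates it. For $A=\{a_1,\ldots,a_n\}$, the $A$-degree of $\mathbf{x}^{\mathbf{u}}=x_1^{u_1}\cdots x_n^{u_n}$ is $\deg_A(\mathbf{x}^{\mathbf{u}})=u_1a_1+\cdots+u_na_n$, and the toric ideal of $A$ is $I_A=\langle \mathbf{x}^{\mathbf{u}}-\mathbf{x}^{\mathbf{v}}\mid \deg_A(\mathbf{x}^{\mathbf{u}})=\deg_A(\mathbf{x}^{\mathbf{v}})\rangle\subseteq\mathbb{K}[x_1,\ldots,x_n]$.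 A numerical semigroup with minimal generating set $\{a_1,\ldots,a_n\}$ is free for the arrangement $(a_1,\ldots,a_n)$ if $\operatorname{lcm}\big(a_i,\gcd(a_{i+1},\ldots,a_n)\big)\in\langle a_{i+1},\ldots,a_n\rangle$ for all $i\in\{1,\ldots,n-1\}$. It is universally free if it is free for every arrangement (ordering) of its minimal generating set. A Markov basis of $I_A$ is a generating set of $I_A$ consisting of binomials $\mathbf{x}^{\mathbf{u}}-\mathbf{x}^{\mathbf{v}}\in I_A$ that is minimal with respect to inclusion. The $A$-degrees of the elements of a Markov basis do not depend on the Markov basis; they are called the Betti degrees of $I_A$, and $\operatorname{Betti}(A)$ is the set of them. A binomial $\mathbf{x}^{\mathbf{u}}-\mathbf{x}^{\mathbf{v}}\in I_A$ is irreducible if $\operatorname{supp}(\mathbf{u})\cap\operatorname{supp}(\mathbf{v})=\emptyset$ (where $\operatorname{supp}(\mathbf{u})=\{i\mid u_i\ne0\}$) and the nonzero entries of $\mathbf{u}+\mathbf{v}$ are relatively prime; a circuit is an irreducible binomial of $I_A$ whose support $\operatorname{supp}(\mathbf{u})\cup\operatorname{supp}(\mathbf{v})$ is minimal with respect to inclusion among the supports of nonzero binomials of $I_A$. Equivalently, the circuits of $I_A$ are the binomials $x_i^{a_j/\gcd(a_i,a_j)}-x_j^{a_i/\gcd(a_i,a_j)}$ with $i\neq j$. *)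

(* Defs.v *)
From mathcomp Require Import all_boot all_order all_fingroup all_algebra.
From mathcomp Require Export mpoly.

Set Implicit Arguments.
Unset Strict Implicit.
Unset Printing Implicit Defensive.

Import GRing.Theory.

(* Finite sets of integers a_1, ..., a_n are families a : 'I_n -> nat; subsets
   are given by sets of indices J.  Indices start at 0. *)
Section Semigroups.
Local Open Scope nat_scope.
Variable n : nat.
Implicit Types (a : 'I_n -> nat) (J : {set 'I_n}) (S : nat -> Prop).

Definition in_gen a J (m : nat) : Prop :=
  exists u : 'I_n -> nat, m = \sum_(i in J) u i * a i.

Definition gcd_of a J : nat := \big[gcdn/0]_(i in J) a i.

Definition generates S a J : Prop := forall m : nat, S m <-> in_gen a J m.

Definition minimal_generating_set S a : Prop :=
  [/\ injective a, forall i, 0 < a i, generates S a [set: 'I_n] &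
      forall J, J \proper [set: 'I_n] -> ~ generates S a J].

Definition free_for_arrangement a : Prop :=
  forall i : 'I_n, i.+1 < n ->
    in_gen a [set j : 'I_n | i < j]
      (lcmn (a i) (gcd_of a [set j : 'I_n | i < j])).

Definition universally_free a : Prop :=
  forall s : 'S_n, free_for_arrangement (fun i => a (s i)).

Definition is_least_multiplier a (i : 'I_n) (c : nat) : Prop :=
  [/\ 0 < c, in_gen a [set~ i] (c * a i) &
      forall c', 0 < c' -> in_gen a [set~ i] (c' * a i) -> c <= c'].

End Semigroups.

Definition numerical_semigroup (S : nat -> Prop) : Prop :=
  exists (k : nat) (g : 'I_k -> nat),
    [/\ forall i, (0 < g i)%N, gcd_of g [set: 'I_k] = 1%N &
        generates S g [set: 'I_k]].

Section ToricIdeals.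
Local Open Scope ring_scope.

Definition ideal_gen (R : comNzRingType) (G : R -> Prop) (p : R) : Prop :=
  exists2 s : seq (R * R),
    (forall c, c \in s -> G c.2) & p = \sum_(c <- s) c.1 * c.2.

Variables (K : fieldType) (n : nat) (a : 'I_n -> nat).
Implicit Types (u v : 'X_{1..n}) (f p : {mpoly K[n]})
  (B C : {mpoly K[n]} -> Prop).

Definition A_deg u : nat := (\sum_(i < n) u i * a i)%N.

Definition binom u v : {mpoly K[n]} := 'X_[u] - 'X_[v].

Definition toric_ideal p : Prop :=
  ideal_gen (fun f => exists u v, A_deg u = A_deg v /\ f = binom u v) p.

Definition generates_toric B : Prop :=
  forall p, ideal_gen B p <-> toric_ideal p.

Definition markov_basis B : Prop :=
  [/\ forall f, B f -> toric_ideal f /\ exists u v, f = binom u v,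
      generates_toric B &
      forall C, (forall f, C f -> B f) -> generates_toric C ->
        forall f, B f -> C f].

(* The set of degrees does not depend on the Markov basis. Elements of a
   Markov basis are nonzero and A-homogeneous, so that the degree of
   x^u - x^v is the common degree of its two monomials. *)
Definition betti_degree (d : nat) : Prop :=
  exists B u v, [/\ markov_basis B, B (binom u v), A_deg u = d & A_deg v = d].

Definition supp u : {set 'I_n} := [set i | u i != 0%N].

(* Null entries do not change a gcd; the gcd of no entry is 0, so that
   x^u - x^v = 0 is never irreducible. *)
Definition irreducible_binom u v : Prop :=
  [/\ toric_ideal (binom u v), [disjoint supp u & supp v] &
      \big[gcdn/0%N]_(i < n) (u i + v i)%N = 1%N].

Definition circuit f : Prop :=
  exists u v,
    [/\ f = binom u v, irreducible_binom u v &
        forall u' v', toric_ideal (binom u' v') -> binom u' v' != 0 ->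
          supp u' :|: supp v' \subset supp u :|: supp v ->
          supp u' :|: supp v' = supp u :|: supp v].

End ToricIdeals.

(* Main.v *)
Require Import Defs.
From mathcomp Require Import all_boot all_order all_fingroup all_algebra.
From mathcomp Require Import zify.
From mathcomp Require Import boolp.
From Stdlib Require Import Relation_Operators.

(** The Betti degrees of a toric ideal are read off its fibers. Say that a
    degree [d] is disconnected over a set [J] of variables when two monomials
    of degree [d] in these variables cannot be joined by a path of monomials
    of degree [d] in which consecutive ones share a variable. Dividing by a
    shared variable turns a step of such a path into a binomial of smaller
    degree; hence a binomial of a Markov basis never joins two connected
    monomials ([betti_fiber_disconnected]), while every generating set of
    binomials needs an element in each disconnected degree
    ([fiber_disconnected_generator]). So the Betti degrees are exactly the
    degrees disconnected over the set of all variables, as soon as one Markov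
    basis is known to exist ([betti_degreeP]).

    Let D(J) be the set of degrees disconnected over [J], and g(J) the gcd of
    the generators indexed by [J]. Universal freeness amounts to
    lcm(a_k, g(J)) being in the semigroup generated by [J] for all nonempty
    [J] and all [k] outside [J] ([universally_free_on_subsets]). The number
    lcm(a_k, g(J)) / a_k divides the difference of the exponents of x_k in any
    two monomials of the same degree in the variables of [J] and x_k, and this
    gives the recursion
      D(k + J) = {lcm(a_k, g(J))} U D(J)        ([fiber_disconnected_glue]).
    As the left-hand side does not depend on which element of k + J is split
    off, playing the choices against each other gives the rest.

    - Some a_k with [k] in [J] divides d in D(J). Split off this [k]: either d
      is lcm(a_k, g(J - k)), or d is the degree of a monomial without x_k, so
      that g(J - k) divides d. In both cases lcm(a_k, g(J - k)) divides d,
      which is (b) because c_k = g(A - a_k) is prime to a_k.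
    - Every lcm(a_i, a_j) is in D(J): split off all the other elements first.
      Conversely let d be in D(J). If d differs from lcm(a_k, g(J - k)) for
      some [k], then d is in D(J - k), and induction applies. Otherwise d
      equals all the lcm(a_k, g(J - k)), so that all the a_k divide d; then
      lcm(a_i, a_j) divides d and is, by the previous point, a multiple of d.
      This is (d).
    - By (d), lcm(a_k, g(J)) is always some lcm(a_k, a_p) with [p] in [J]: the
      monomial glued to the power of x_k can be chosen to be a power of x_p.
      Gluing the variables one after the other yields n - 1 circuits that
      generate the ideal ([circuit_system]). They form a triangular system, so
      that each of them is detected by a weight of the variables for which all
      the others are homogeneous; hence none of them can be dropped. This
      is (c). *)

Set Implicit Arguments.
Unset Strict Implicit.
Unset Printing Implicit Defensive.

Import GRing.Theory.

Notation connected R := (clos_refl_sym_trans _ R).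

(** * Disconnected fibers and gluing *)

Section Degrees.
Local Open Scope nat_scope.
Variables (n : nat) (a : 'I_n -> nat).
Implicit Types (u v w m p q : 'X_{1..n}) (J : {set 'I_n}) (i j k : 'I_n).

Lemma A_degD u v : A_deg a (u + v)%MM = A_deg a u + A_deg a v.
Proof.
by rewrite /A_deg -big_split; apply: eq_bigr => i _; rewrite mnmDE mulnDl.
Qed.

Lemma A_degMU i c : A_deg a (U_(i) *+ c)%MM = c * a i.
Proof.
rewrite /A_deg (bigD1 i) //= big1 ?addn0 ?mulmnE ?mnm1E ?eqxx ?mul1n //.
by move=> j /negPf ji; rewrite mulmnE mnm1E eq_sym ji.
Qed.

Lemma A_degB u v : (forall i, v i <= u i) ->
  A_deg a (u - v)%MM + A_deg a v = A_deg a u.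
Proof.
move=> le_vu; rewrite -A_degD; congr A_deg.
by apply/mnmP => i; rewrite mnmDE mnmBE subnK.
Qed.

Lemma supp_subP u J :
  reflect (forall i, i \notin J -> u i = 0) (supp u \subset J).
Proof.
apply: (iffP subsetP) => [suJ i|u0 i].
  by apply: contraNeq => ui; apply: suJ; rewrite inE.
by rewrite inE; apply: contraR => /u0 ->.
Qed.

Lemma suppD_sub u v J :
  supp u \subset J -> supp v \subset J -> supp (u + v)%MM \subset J.
Proof.
move=> /supp_subP u0 /supp_subP v0; apply/supp_subP => i iJ.
by rewrite mnmDE u0 ?v0.
Qed.

Lemma suppB_sub u v J : supp u \subset J -> supp (u - v)%MM \subset J.
Proof.
by move=> /supp_subP u0; apply/supp_subP => i iJ; rewrite mnmBE u0.
Qed.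

Lemma suppMU_sub i c J : i \in J -> supp (U_(i) *+ c)%MM \subset J.
Proof.
move=> iJ; apply/supp_subP => j; rewrite mulmnE mnm1E.
by case: eqVneq => // <-; rewrite iJ.
Qed.

Lemma A_deg_sum u J :
  supp u \subset J -> A_deg a u = \sum_(j in J) u j * a j.
Proof.
move=> /supp_subP u0; rewrite /A_deg [RHS]big_mkcond; apply: eq_bigr => i _.
by case: ifPn => // /u0 ->.
Qed.

Lemma A_deg_split u k J : k \notin J -> supp u \subset k |: J ->
  A_deg a u = u k * a k + \sum_(j in J) u j * a j.
Proof. by move=> kJ suJ; rewrite (A_deg_sum suJ) big_setU1. Qed.

Lemma gcd_dvd_sum (x : 'I_n -> nat) J : gcd_of a J %| \sum_(j in J) x j * a j.
Proof. by apply: dvdn_sum => j jJ; rewrite dvdn_mull // (biggcdn_inf j). Qed.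

Lemma in_gen_dvd J d : in_gen a J d -> gcd_of a J %| d.
Proof. by case=> x ->; apply: gcd_dvd_sum. Qed.

Lemma in_gen_mnm J d : in_gen a J d ->
  exists2 m : 'X_{1..n}, supp m \subset J & A_deg a m = d.
Proof.
case=> x ->; pose m := [multinom (if i \in J then x i else 0) | i < n].
have sm : supp m \subset J by apply/supp_subP => i /negPf iJ; rewrite mnmE iJ.
exists m => //; rewrite (A_deg_sum sm).
by apply: eq_bigr => i iJ; rewrite mnmE iJ.
Qed.

Lemma gcd_dvd_deg u J : supp u \subset J -> gcd_of a J %| A_deg a u.
Proof. by move=> suJ; rewrite (A_deg_sum suJ) gcd_dvd_sum. Qed.

(** The other variables only contribute multiples of the gcd of [J] to the
    common degree. *)
Lemma lcm_dvd_exp_diff k J u v : k \notin J ->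
    supp u \subset k |: J -> supp v \subset k |: J ->
    A_deg a u = A_deg a v -> v k <= u k ->
  lcmn (a k) (gcd_of a J) %| (u k - v k) * a k.
Proof.
move=> kJ su sv duv le_vu; rewrite dvdn_lcm dvdn_mull //=.
rewrite -(dvdn_addl _ (gcd_dvd_sum u J)).
suff -> : (u k - v k) * a k + \sum_(j in J) u j * a j = \sum_(j in J) v j * a j.
  exact: gcd_dvd_sum.
move: duv; rewrite (A_deg_split kJ su) (A_deg_split kJ sv) mulnBl.
have : v k * a k <= u k * a k by rewrite leq_mul2r le_vu orbT.
lia.
Qed.

Definition shares_variable J u v : Prop :=
  [/\ supp u \subset J, supp v \subset J, A_deg a u = A_deg a v &
      exists2 i, u i != 0 & v i != 0].

(** This says that the simplicial complex of the supports of the monomials of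
    degree [d] in the variables of [J] is disconnected. *)
Definition fiber_disconnected J (d : nat) : Prop :=
  exists u v, [/\ supp u \subset J, supp v \subset J,
    A_deg a u = d, A_deg a v = d & ~ connected (shares_variable J) u v].

Lemma shares_variable_connectedS J u v k :
  connected (shares_variable J) u v ->
  connected (shares_variable (k |: J)) u v.
Proof.
elim=> [x y [sx sy dxy cxy]|x|x y _ IH|x y z _ IH1 _ IH2].
- by apply: rst_step; split=> //; apply: subset_trans (subsetUr _ _).
- exact: rst_refl.
- exact: rst_sym.
- exact: rst_trans IH1 IH2.
Qed.

Hypothesis a_gt0 : forall i, 0 < a i.

Lemma A_deg_eq0 u : A_deg a u = 0 -> u = 0%MM.
Proof.
move/eqP; rewrite sum_nat_eq0 => /forallP u0; apply/mnmP => i.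
by move/eqP: (u0 i) (a_gt0 i); rewrite mnm0E; lia.
Qed.

Lemma mnm_neq0 u : A_deg a u != 0 -> exists i, u i != 0.
Proof.
move=> du; apply/existsP; apply: contraR du => /existsPn u0.
by rewrite /A_deg big1 // => i _; move: (u0 i); rewrite negbK => /eqP ->.
Qed.

(** Gluing a variable x_k to those of [J] along a monomial [m] of degree
    lcm(a_k, gcd J): the new relation is x_k ^ c = [m]. *)
Section Gluing.
Variables (k : 'I_n) (J : {set 'I_n}) (m : 'X_{1..n}).
Let d0 := lcmn (a k) (gcd_of a J).
Let c := d0 %/ a k.
Hypotheses (kJ : k \notin J) (J_neq0 : J != set0).
Hypotheses (supp_m : supp m \subset J) (deg_m : A_deg a m = d0).

Lemma gcd_of_gt0 : 0 < gcd_of a J.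
Proof.
have [i iJ] := set0Pn _ J_neq0.
by apply: (@dvdn_gt0 _ (a i)) => //; apply: biggcdn_inf iJ _.
Qed.

Lemma glue_deg_gt0 : 0 < d0.
Proof. by rewrite lcmn_gt0 a_gt0 gcd_of_gt0. Qed.

Lemma glue_exp : c * a k = d0.
Proof. by rewrite divnK ?dvdn_lcml. Qed.

Lemma glue_exp_gt0 : 0 < c.
Proof. by move: glue_deg_gt0; rewrite -glue_exp; case: c. Qed.

Lemma glue_exp_dvd u v : supp u \subset k |: J -> supp v \subset k |: J ->
  A_deg a u = A_deg a v -> v k <= u k -> c %| u k - v k.
Proof.
move=> su sv duv le_vu; have := lcm_dvd_exp_diff kJ su sv duv le_vu.
by rewrite -/d0 -glue_exp dvdn_pmul2r.
Qed.

Let m_k : m k = 0. Proof. by move/supp_subP: supp_m; apply. Qed.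

Lemma sub_glue w : supp w \subset J -> supp w \subset k |: J.
Proof. by move/subset_trans; apply; apply: subsetUr. Qed.

Lemma glue_down u : supp u \subset k |: J -> c <= u k ->
  let u' := (u - U_(k) *+ c + m)%MM in
  [/\ supp u' \subset k |: J, A_deg a u' = A_deg a u & u' k = u k - c].
Proof.
move=> su le_cu; split.
- by rewrite suppD_sub ?suppB_sub ?(sub_glue supp_m).
- rewrite A_degD deg_m -(@A_degB u (U_(k) *+ c)%MM) ?A_degMU ?glue_exp //.
  by move=> i; rewrite mulmnE mnm1E; case: eqVneq => // <-; rewrite mul1n.
- by rewrite mnmDE m_k addn0 mnmBE mulmnE mnm1E eqxx mul1n.
Qed.

(** The case of equality of degrees is excluded because there [u] is the power
    x_k ^ c itself, which has nothing in common with [m]. *)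
Lemma glue_step u : supp u \subset k |: J -> c <= u k -> A_deg a u != d0 ->
  shares_variable (k |: J) u ((u - U_(k) *+ c) + m)%MM.
Proof.
move=> su le_cu du; have [su' du' _] := glue_down su le_cu.
split=> //; have [|i ui] := @mnm_neq0 (u - U_(k) *+ c)%MM.
  move: du' du; rewrite A_degD deg_m => <-; apply: contraNneq => ->.
  by rewrite add0n.
exists i; last by rewrite mnmDE addn_eq0 negb_and ui.
by apply: contraNneq ui; rewrite mnmBE => ->.
Qed.

(** Outside the glued degree, the relation x_k ^ c = [m] is a step between
    monomials that share a variable, so it can be used to eliminate x_k. *)
Lemma fiber_disconnected_glue_sub d :
  fiber_disconnected (k |: J) d -> d = d0 \/ fiber_disconnected J d.
Proof.
case: (eqVneq d d0) => [->|d_neq]; first by left.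
case=> u [v [su sv du dv nuv]]; right; apply: contrapT => conJ.
have{}conJ x y : supp x \subset J -> supp y \subset J ->
    A_deg a x = d -> A_deg a y = d ->
    connected (shares_variable (k |: J)) x y.
  move=> sx sy dx dy; apply: shares_variable_connectedS.
  by apply: contrapT => nxy; apply: conJ; exists x, y.
have sub_k0 x : supp x \subset k |: J -> x k = 0 -> supp x \subset J.
  move=> /supp_subP sx xk; apply/supp_subP => i iJ.
  by case: (eqVneq i k) => [->//|ik]; rewrite sx // !inE negb_or ik.
have down x y : supp x \subset k |: J -> supp y \subset k |: J ->
    A_deg a x = d -> A_deg a y = d -> y k = 0 ->
    connected (shares_variable (k |: J)) x y.
  move=> + sy + dy yk.
  have [N] := ubnP (x k); elim: N => // N IH in x * => xN sx dx.
  case: (posnP (x k)) => [xk|xk]; first by apply: conJ; rewrite ?sub_k0.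
  have le_cx : c <= x k.
    have := glue_exp_dvd sx sy; rewrite dx dy yk subn0 => /(_ erefl isT).
    by apply: dvdn_leq.
  have [sx' dx' x'k] := glue_down sx le_cx.
  apply: rst_trans (rst_step _ _ _ _ (glue_step sx le_cx _)) (IH _ _ _ _) => //.
  - by rewrite dx.
  - by rewrite x'k; have := glue_exp_gt0; lia.
  - by rewrite dx'.
apply: nuv; case: (eqVneq (v k) 0) => [vk|vk]; first exact: down.
case: (eqVneq (u k) 0) => [uk|uk]; first by apply/rst_sym/down.
by apply: rst_step; split; rewrite ?du ?dv //; exists k.
Qed.

(** In the glued degree x_k ^ c is the only monomial that involves x_k, so it
    is isolated from [m]. *)
Lemma fiber_disconnected_glue_deg : fiber_disconnected (k |: J) d0.
Proof.
have skJ : k \in k |: J by rewrite setU11.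
exists (U_(k) *+ c)%MM, m; split; rewrite ?suppMU_sub ?(sub_glue supp_m) //.
  by rewrite A_degMU glue_exp.
have alone x y : shares_variable (k |: J) x y ->
    x = (U_(k) *+ c)%MM -> y = (U_(k) *+ c)%MM.
  move=> [sx sy dxy [i xi yi]] Ex; move: xi; rewrite Ex mulmnE mnm1E.
  case: (eqVneq k i) => [ki _|_]; last by rewrite mul0n eqxx.
  move: yi; rewrite -{}ki => yk.
  have dy : A_deg a y = d0 by rewrite -dxy Ex A_degMU glue_exp.
  have le_cy : c <= y k.
    have := glue_exp_dvd sy (sub_glue supp_m); rewrite dy deg_m m_k subn0.
    by move=> /(_ erefl isT); apply: dvdn_leq; rewrite lt0n.
  have /A_deg_eq0 y0 : A_deg a (y - U_(k) *+ c)%MM = 0.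
    have := glue_down sy le_cy; case=> _ + _.
    by rewrite A_degD deg_m dy => /eqP; rewrite -{2}[d0]add0n eqn_add2r => /eqP.
  apply/mnmP => i'; move/mnmP/(_ i'): y0; rewrite mnmBE mnm0E mulmnE mnm1E.
  case: eqVneq => [<-|_]; last by rewrite subn0.
  by rewrite mul1n; lia.
have symS x y : shares_variable (k |: J) x y -> shares_variable (k |: J) y x.
  by case=> sx sy dxy [i xi yi]; split=> //; exists i.
have inv x y : connected (shares_variable (k |: J)) x y ->
    x = (U_(k) *+ c)%MM <-> y = (U_(k) *+ c)%MM.
  elim=> [{}x {}y xy|//|{}x {}y _ [? ?]|{}x {}y z _ [? ?] _ [? ?]].
  - by split; apply: alone => //; apply: symS.
  - by split.
  - by split; auto.
case/inv => /(_ erefl) Em _; move: m_k glue_exp_gt0.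
by rewrite Em mulmnE mnm1E eqxx mul1n => ->.
Qed.

(** Replacing x_k ^ c by [m] as often as possible retracts the fiber onto the
    monomials in the variables of [J]. It preserves the sharing of a variable:
    if the shared variable is x_k, both images are multiples of [m]. *)
Lemma fiber_disconnected_glue_sup d :
  fiber_disconnected J d -> fiber_disconnected (k |: J) d.
Proof.
case=> u [v [su sv du dv nuv]]; exists u, v; split; rewrite ?sub_glue // => cuv.
have outJ w : supp w \subset J -> w k = 0 by move/supp_subP; apply.
(* [r] is the retraction; [c] divides the exponent of x_k all along the path. *)
pose r w := [multinom (if i == k then 0 else w i) + w k %/ c * m i | i < n].
have rk w : r w k = 0 by rewrite mnmE eqxx m_k muln0.
have supp_r w : supp w \subset k |: J -> supp (r w) \subset J.
  move=> /supp_subP sw; apply/supp_subP => i iJ.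
  rewrite mnmE; have -> : m i = 0 by move/supp_subP: supp_m; apply.
  by rewrite muln0; case: eqVneq => // ik; rewrite sw // !inE negb_or ik.
have k_dvd w : supp w \subset k |: J -> A_deg a w = d -> c %| w k.
  move=> sw dw; have := glue_exp_dvd sw (sub_glue su).
  by rewrite dw du (outJ u) // subn0; apply.
have deg_r w : supp w \subset k |: J -> A_deg a w = d -> A_deg a (r w) = d.
  move=> sw dw; rewrite -dw (A_deg_split kJ sw) (A_deg_sum (supp_r _ sw)).
  rewrite -{1}(divnK (k_dvd w sw dw)) -mulnA glue_exp -deg_m (A_deg_sum supp_m).
  rewrite big_distrr addnC -big_split; apply: eq_bigr => i iJ.
  rewrite mnmE ifN_eq ?mulnDl -?mulnA //.
  by apply: contraNneq kJ => <-.
have r_id w : supp w \subset J -> r w = w.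
  move=> sw; apply/mnmP => i; rewrite mnmE outJ // div0n addn0.
  by case: eqVneq => // ->; rewrite outJ.
have lift x y : connected (shares_variable (k |: J)) x y ->
    A_deg a x = A_deg a y /\
    (A_deg a x = d -> connected (shares_variable J) (r x) (r y)).
  elim=> [{}x {}y [sx sy dxy [i xi yi]]|{}x|{}x {}y _ [dxy IH]|
          {}x {}y z _ [dxy IH1] _ [dyz IH2]].
  - split=> // dx; have dy : A_deg a y = d by rewrite -dxy.
    apply: rst_step; split; rewrite ?supp_r // ?deg_r //.
    case: (eqVneq i k) => [ik|ik]; last first.
      by exists i; rewrite mnmE (negPf ik) addn_eq0 negb_and ?xi ?yi.
    have [|j mj] := @mnm_neq0 m.
      by rewrite deg_m -lt0n glue_deg_gt0.
    have pos w : supp w \subset k |: J -> A_deg a w = d -> w i != 0 ->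
        r w j != 0.
      rewrite ik => sw dw wk; rewrite mnmE addn_eq0 negb_and orbC.
      rewrite muln_eq0 negb_or mj andbT -lt0n divn_gt0 ?glue_exp_gt0 //.
      by rewrite dvdn_leq ?lt0n ?k_dvd.
    by exists j; apply: pos.
  - by split=> // _; apply: rst_refl.
  - by split=> [//|dy]; apply/rst_sym/IH; rewrite dxy.
  - split=> [|dx]; first by rewrite dxy.
    by apply: rst_trans (IH1 dx) (IH2 _); rewrite -dxy.
by have [_ /(_ du)] := lift _ _ cuv; rewrite !r_id.
Qed.

Lemma fiber_disconnected_glue d :
  fiber_disconnected (k |: J) d <-> d = d0 \/ fiber_disconnected J d.
Proof.
split; first exact: fiber_disconnected_glue_sub.
case=> [->|]; first exact: fiber_disconnected_glue_deg.
exact: fiber_disconnected_glue_sup.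
Qed.

End Gluing.
End Degrees.

(** * Disconnected degrees of universally free semigroups *)

Section UniversallyFree.
Local Open Scope nat_scope.
Variables (n : nat) (a : 'I_n -> nat).
Implicit Types (u v w p q : 'X_{1..n}) (J : {set 'I_n}) (i j k : 'I_n).

Definition free_on_subsets : Prop := forall k J, k \notin J -> J != set0 ->
  in_gen a J (lcmn (a k) (gcd_of a J)).

Lemma exists_perm_tail k J : k \notin J ->
  exists (s : 'S_n) (r : 'I_n),
    [/\ s r = k, J != set0 -> r.+1 < n & forall i, (s i \in J) = (r < i)].
Proof.
move=> kJ; pose l := enum (~: (k |: J)) ++ k :: enum J.
have size_l : size l = n.
  have := cardsC (k |: J); rewrite (cardsU1 k J) kJ card_ord size_cat /= -!cardE.
  by rewrite add1n addnC.
have uniq_l : uniq l.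
  rewrite cat_uniq /= !enum_uniq !mem_enum !inE eqxx kJ /= andbT.
  apply/hasPn => i; rewrite !mem_enum => iJ.
  by rewrite !inE iJ orbT.
have inj_l : injective (fun i : 'I_n => nth k l i).
  move=> i j /eqP; rewrite nth_uniq ?size_l // => /eqP.
  exact: val_inj.
have r_lt : size (enum (~: (k |: J))) < n.
  by move: size_l; rewrite size_cat /=; lia.
exists (perm inj_l), (Ordinal r_lt); split.
- by rewrite permE /= nth_cat ltnn subnn.
- rewrite -card_gt0 cardE /=; move: size_l; rewrite size_cat /=.
  by lia.
- move=> i; rewrite permE /= nth_cat; case: ltngtP => /= [lt_i|gt_i|->].
  + apply/negP => iJ; have := mem_nth k lt_i.
    by rewrite mem_enum !inE iJ orbT.
  + rewrite -(subnSK gt_i) /= -mem_enum mem_nth //.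
    rewrite -(ltn_add2r (size (enum (~: (k |: J)))).+1) subnK // addnC addSnnS.
    by move: size_l; rewrite size_cat => ->.
  + by rewrite subnn /= (negPf kJ).
Qed.

(** An arrangement that ends with [k] followed by the elements of [J] carries
    this condition at the position of [k]. *)
Lemma universally_free_on_subsets : universally_free a -> free_on_subsets.
Proof.
move=> a_free k J kJ J_neq0; have [s [r [sr r_lt sJ]]] := exists_perm_tail kJ.
have big_s (R : Type) (x : R) (op : Monoid.com_law x) (F : 'I_n -> R) :
    \big[op/x]_(i in [set i : 'I_n | r < i]) F (s i) = \big[op/x]_(i in J) F i.
  rewrite [RHS](reindex_inj (@perm_inj _ s)); apply: eq_bigl => i.
  by rewrite inE sJ.
have [x] := a_free s r (r_lt J_neq0).
rewrite /gcd_of (big_s _ _ _ a) sr => ->; exists (fun j => x (s^-1%g j)).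
rewrite -(big_s _ _ _ (fun j => x (s^-1%g j) * a j)).
by apply: eq_bigr => i _; rewrite permK.
Qed.

Hypotheses (a_gt0 : forall i, 0 < a i) (a_free : free_on_subsets).

Lemma fiber_disconnected_setU1 k J d : k \notin J -> J != set0 ->
  fiber_disconnected a (k |: J) d <->
    d = lcmn (a k) (gcd_of a J) \/ fiber_disconnected a J d.
Proof.
move=> kJ J_neq0; have [m sm dm] := in_gen_mnm (a_free kJ J_neq0).
exact: fiber_disconnected_glue sm dm d.
Qed.

Lemma mnm_sub1_inj k u v : supp u \subset [set k] -> supp v \subset [set k] ->
  A_deg a u = A_deg a v -> u = v.
Proof.
move=> su sv duv.
have deg w : supp w \subset [set k] -> A_deg a w = w k * a k.
  by move=> sw; rewrite (A_deg_sum a sw) big_set1.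
apply/mnmP => i; case: (eqVneq i k) => [->|ik].
  by apply/eqP; rewrite -(eqn_pmul2r (a_gt0 k)) -!deg ?duv.
by move: su sv => /supp_subP su /supp_subP sv; rewrite su ?sv ?inE.
Qed.

Lemma fiber_disconnected_sub1 k J d :
  J \subset [set k] -> ~ fiber_disconnected a J d.
Proof.
move=> sJ [u [v [su sv du dv]]]; apply; rewrite (@mnm_sub1_inj k u v).
- exact: rst_refl.
- exact: subset_trans su sJ.
- exact: subset_trans sv sJ.
- by rewrite du.
Qed.

Lemma fiber_disconnected_pair J d :
  fiber_disconnected a J d -> forall k, k \in J -> J :\ k != set0.
Proof.
move=> dJ k kJ; apply: contraPneq dJ => J0.
by apply: (@fiber_disconnected_sub1 k); rewrite -(setD1K kJ) J0 setU0.
Qed.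

Lemma fiber_disconnected_setD1 J d k : k \in J -> fiber_disconnected a J d ->
  d = lcmn (a k) (gcd_of a (J :\ k)) \/ fiber_disconnected a (J :\ k) d.
Proof.
move=> kJ dJ; have J'_neq0 := fiber_disconnected_pair dJ kJ.
by apply/fiber_disconnected_setU1; rewrite ?setD11 ?setD1K.
Qed.

Lemma fiber_disconnected_neq0 J d :
  fiber_disconnected a J d -> exists k, k \in J.
Proof.
move=> dJ; apply/set0Pn; apply: contraPneq dJ => -> [u [v [su sv _ _]]]; apply.
suff -> : u = v by apply: rst_refl.
move/supp_subP: su => su; move/supp_subP: sv => sv.
by apply/mnmP => i; rewrite su ?sv ?inE.
Qed.

Lemma fiber_disconnected_dvd_gen J d :
  fiber_disconnected a J d -> exists2 i, i \in J & a i %| d.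
Proof.
have [N] := ubnP #|J|; elim: N => // N IH in J * => J_lt dJ.
have [k kJ] := fiber_disconnected_neq0 dJ.
case: (fiber_disconnected_setD1 kJ dJ) => [->|dJ'].
  by exists k => //; apply: dvdn_lcml.
have [|i] := IH _ _ dJ'; first by move: J_lt; rewrite (cardsD1 k J) kJ.
by rewrite inE => /andP[_ iJ] ai; exists i.
Qed.

(** Take [k] with a_k dividing [d]. If [d] is not the degree glued with x_k,
    it is the degree of a monomial that does not involve x_k, hence a multiple
    of the gcd of the other generators. *)
Lemma fiber_disconnected_dvd_lcm_gcd J d : fiber_disconnected a J d ->
  exists2 k, k \in J & lcmn (a k) (gcd_of a (J :\ k)) %| d.
Proof.
move=> dJ; have [k kJ ak_d] := fiber_disconnected_dvd_gen dJ; exists k => //.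
case: (fiber_disconnected_setD1 kJ dJ) => [->//|[u [_ [su _ du _ _]]]].
by rewrite dvdn_lcm ak_d -du gcd_dvd_deg.
Qed.

(** Splitting off all the other variables leaves [i] and [j], whose only
    relation is their circuit. *)
Lemma lcm_fiber_disconnected i j J : i \in J -> j \in J -> i != j ->
  fiber_disconnected a J (lcmn (a i) (a j)).
Proof.
have [N] := ubnP #|J|; elim: N => // N IH in J * => J_lt iJ jJ ij.
have [k /and3P[kJ ki kj]|J_ij] :=
  pickP [pred k | [&& k \in J, k != i & k != j]].
  have iJ' : i \in J :\ k by rewrite !inE eq_sym ki.
  have jJ' : j \in J :\ k by rewrite !inE eq_sym kj.
  rewrite -(setD1K kJ); apply/fiber_disconnected_setU1; rewrite ?setD11 //.
    by apply/set0Pn; exists i.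
  by right; apply: IH => //; move: J_lt; rewrite (cardsD1 k J) kJ.
have -> : J = i |: [set j].
  apply/setP => k; have := J_ij k; rewrite !inE.
  case: (eqVneq k i) => [->|_]; first by rewrite iJ.
  by case: (eqVneq k j) => [->|_]; rewrite ?jJ //= andbT.
apply/fiber_disconnected_setU1; rewrite ?inE //.
  by apply/set0Pn; exists j; rewrite inE.
by left; rewrite /gcd_of big_set1.
Qed.

(** Induction on [J], unless [d] is the degree glued with x_k for all [k] in
    [J]; then every lcm(a_i, a_j) divides [d], and is a multiple of one of the
    glued degrees, that is of [d]. *)
Lemma fiber_disconnected_lcm J d : fiber_disconnected a J d ->
  exists i j, [/\ i \in J, j \in J, i != j & d = lcmn (a i) (a j)].
Proof.
have [N] := ubnP #|J|; elim: N => // N IH in J d * => J_lt dJ.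
case: (boolP [exists k in J, d != lcmn (a k) (gcd_of a (J :\ k))]).
  move=> /exists_inP[k kJ /eqP d_neq].
  case: (fiber_disconnected_setD1 kJ dJ) => [//|dJ'].
  have [|i [j [iJ jJ ij ->]]] := IH _ _ _ dJ'.
    by move: J_lt; rewrite (cardsD1 k J) kJ.
  by exists i, j; move: iJ jJ; rewrite !inE => /andP[_ ->] /andP[_ ->].
move=> /exists_inPn all_d.
have {}all_d k : k \in J -> d = lcmn (a k) (gcd_of a (J :\ k)).
  by move/all_d; rewrite negbK => /eqP.
have [i iJ] := fiber_disconnected_neq0 dJ.
have /set0Pn[j] := fiber_disconnected_pair dJ iJ.
rewrite !inE => /andP[ji jJ]; exists i, j; rewrite eq_sym ji; split=> //.
apply/eqP; rewrite eqn_dvd [X in _ && X]dvdn_lcm.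
rewrite {2}(all_d i iJ) {2}(all_d j jJ) !dvdn_lcml !andbT.
have := lcm_fiber_disconnected jJ iJ ji; rewrite lcmnC.
by case/fiber_disconnected_dvd_lcm_gcd => k kJ; rewrite -all_d.
Qed.

(** * Circuits generating the congruence of equal degrees *)

Definition circuit_exp i j : 'X_{1..n} := (U_(i) *+ (lcmn (a i) (a j) %/ a i))%MM.

Lemma A_deg_circuit_exp i j : A_deg a (circuit_exp i j) = lcmn (a i) (a j).
Proof. by rewrite A_degMU divnK ?dvdn_lcml. Qed.

Lemma circuit_exp_gt0 i j : 0 < lcmn (a i) (a j) %/ a i.
Proof. by rewrite divn_gt0 // dvdn_leq ?dvdn_lcml // lcmn_gt0 !a_gt0. Qed.

(** The glued degree is some lcm(a_i, a_j), and [i] or [j] differs from [k]: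
    a relation eliminating x_k can be chosen to be a circuit. *)
Lemma lcm_gcd_eq_lcm k J : k \notin J -> J != set0 ->
  exists2 p, p \in J & lcmn (a k) (gcd_of a J) = lcmn (a k) (a p).
Proof.
move=> kJ J_neq0; set d := lcmn _ _.
have : fiber_disconnected a (k |: J) d.
  by apply/fiber_disconnected_setU1 => //; left.
case/fiber_disconnected_lcm => i [j [iJ jJ ij d_ij]].
have [p pJ ap_d] : exists2 p, p \in J & a p %| d.
  move: iJ jJ ij; rewrite !inE; case: (eqVneq i k) => [->|_] /=.
    move=> _ + kj; rewrite eq_sym (negPf kj) => jJ.
    by exists j; rewrite ?d_ij ?dvdn_lcmr.
  by move=> iJ _ _; exists i; rewrite ?d_ij ?dvdn_lcml.
exists p => //; apply/eqP; rewrite eqn_dvd !dvdn_lcm dvdn_lcml dvdn_lcml ap_d /=.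
rewrite andbT (dvdn_trans _ (dvdn_lcmr _ _)) //.
by apply: biggcdn_inf pJ _.
Qed.

Definition monomial_moves (G : 'X_{1..n} -> 'X_{1..n} -> Prop) u v : Prop :=
  exists w p q, [/\ G p q, u = (w + p)%MM & v = (w + q)%MM].

Lemma moves_add G u v w : connected (monomial_moves G) u v ->
  connected (monomial_moves G) (w + u)%MM (w + v)%MM.
Proof.
elim=> [x y [z [p [q [Gpq -> ->]]]]|x|x y _ IH|x y z _ IH1 _ IH2].
- by apply: rst_step; exists (w + z)%MM, p, q; rewrite !addmA.
- exact: rst_refl.
- exact: rst_sym.
- exact: rst_trans IH1 IH2.
Qed.

Lemma moves_mono (G G' : 'X_{1..n} -> 'X_{1..n} -> Prop) u v :
    (forall p q, G p q -> connected (monomial_moves G') p q) ->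
  connected (monomial_moves G) u v -> connected (monomial_moves G') u v.
Proof.
move=> GG'; elim=> [x y [z [p [q [Gpq -> ->]]]]|x|x y _ IH|x y z _ IH1 _ IH2].
- exact/moves_add/GG'.
- exact: rst_refl.
- exact: rst_sym.
- exact: rst_trans IH1 IH2.
Qed.

Definition circuit_pairs (t : seq ('I_n * 'I_n)) p q : Prop :=
  exists2 e, e \in t & p = circuit_exp e.1 e.2 /\ q = circuit_exp e.2 e.1.

(** Choosing one circuit for each variable split off from [J] gives enough
    moves to join all monomials of the same degree: two such monomials have
    congruent exponents of the split variable, and its circuit lowers that
    exponent by exactly the modulus. The weights [psi] witness that the system is
    triangular, hence independent: they show that no circuit is redundant. *)
Lemma circuit_system J : J != set0 -> exists t : seq ('I_n * 'I_n),
  [/\ uniq t, size t = #|J|.-1,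
      forall e, e \in t -> [/\ e.1 != e.2, e.1 \in J & e.2 \in J],
      forall u v, supp u \subset J -> supp v \subset J ->
        A_deg a u = A_deg a v ->
        connected (monomial_moves (circuit_pairs t)) u v &
      forall e, e \in t -> exists psi : 'I_n -> nat,
        A_deg psi (circuit_exp e.1 e.2) <> A_deg psi (circuit_exp e.2 e.1) /\
        forall e', e' \in t -> e' != e ->
          A_deg psi (circuit_exp e'.1 e'.2) = A_deg psi (circuit_exp e'.2 e'.1)].
Proof.
have [N] := ubnP #|J|; elim: N => // N IH in J * => J_lt J_neq0.
have [k kJ] := set0Pn _ J_neq0.
have [J'0|J'_neq0] := eqVneq (J :\ k) set0.
  have {kJ J_lt J_neq0} -> : J = [set k] by rewrite -(setD1K kJ) J'0 setU0.
  exists [::]; split=> //; first by rewrite cards1.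
  by move=> u v su sv duv; rewrite (mnm_sub1_inj su sv duv); apply: rst_refl.
have kJ' : k \notin J :\ k by rewrite setD11.
have [|t' [uniq_t' size_t' t'J' t'_gen t'_sep]] := IH _ _ J'_neq0.
  by move: J_lt; rewrite (cardsD1 k J) kJ.
have [p pJ' lcm_kp] := lcm_gcd_eq_lcm kJ' J'_neq0.
have pk : p != k by move: pJ'; rewrite !inE => /andP[].
have t'k e : e \in t' -> e.1 != k /\ e.2 != k.
  by case/t'J' => _; rewrite !inE => /andP[-> _] /andP[-> _].
have kp_t' : (k, p) \notin t' by apply/negP => /t'k[/=]; rewrite eqxx.
exists ((k, p) :: t'); split.
- by rewrite /= kp_t'.
- rewrite /= size_t' (cardsD1 k J) kJ add1n prednK //.
  by rewrite card_gt0.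
- move=> e; rewrite inE => /predU1P[->|/t'J'[e12]] /=.
    by move: pJ'; rewrite !inE eq_sym kJ => /andP[-> ->].
  by rewrite !inE => /andP[_ ->] /andP[_ ->].
- pose G := circuit_pairs ((k, p) :: t').
  have sm : supp (circuit_exp p k) \subset J :\ k by apply: suppMU_sub.
  have dm : A_deg a (circuit_exp p k) = lcmn (a k) (gcd_of a (J :\ k)).
    by rewrite A_deg_circuit_exp lcm_kp lcmnC.
  have cE : circuit_exp k p =
      (U_(k) *+ (lcmn (a k) (gcd_of a (J :\ k)) %/ a k))%MM.
    by rewrite /circuit_exp lcm_kp.
  have down u v : supp u \subset J -> supp v \subset J ->
      A_deg a u = A_deg a v -> v k <= u k -> connected (monomial_moves G) u v.
    move=> + sv + +.
    have [M] := ubnP (u k); elim: M => // M IHM in u * => u_lt su duv le_vu.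
    have [uvk|uvk] := eqVneq (u k) (v k).
      have rest w : supp w \subset J ->
          w = (U_(k) *+ w k + (w - U_(k) *+ w k))%MM /\
          supp (w - U_(k) *+ w k)%MM \subset J :\ k.
        move=> /supp_subP sw; split.
          apply/mnmP => i; rewrite mnmDE mnmBE mulmnE mnm1E.
          by case: eqVneq => [<-|_]; rewrite ?mul1n ?subnn ?subn0 ?addn0.
        apply/supp_subP => i; rewrite mnmBE mulmnE mnm1E !inE.
        case: eqVneq => [<-|_] /=; first by rewrite mul1n subnn.
        by move/sw => ->.
      have [Eu su'] := rest u su; have [Ev sv'] := rest v sv.
      rewrite Eu Ev uvk; apply: moves_add.
      apply: (@moves_mono (circuit_pairs t')).
        move=> x y [e et' [-> ->]]; apply: rst_step; exists 0%MM.
        exists (circuit_exp e.1 e.2), (circuit_exp e.2 e.1).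
        by rewrite !add0m; split=> //; exists e; rewrite ?inE ?et' ?orbT.
      apply: t'_gen; rewrite -?uvk // uvk //.
      by move: duv; rewrite {1}Eu {1}Ev !A_degD uvk => /addnI.
    have le_c : lcmn (a k) (gcd_of a (J :\ k)) %/ a k <= u k - v k.
      apply: dvdn_leq; first by rewrite subn_gt0 ltn_neqAle eq_sym uvk.
      by apply: (glue_exp_dvd _ kJ'); rewrite ?setD1K.
    have c_gt0 : 0 < lcmn (a k) (gcd_of a (J :\ k)) %/ a k.
      exact: glue_exp_gt0.
    have [||su' du' u'k] := glue_down kJ' sm dm (u := u).
    + by rewrite setD1K.
    + exact: leq_trans le_c (leq_subr _ _).
    have [le_cu [le_vu' u'_lt]] :
        let c := lcmn (a k) (gcd_of a (J :\ k)) %/ a k in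
        c <= u k /\ v k <= u k - c /\ u k - c < M.
      move: c_gt0 le_c le_vu u_lt; move: (_ %/ _) (u k) (v k) => c x y.
      by clear; lia.
    apply: rst_trans (rst_step _ _ _ _ _) (IHM _ _ _ _ _).
    + exists (u - circuit_exp k p)%MM, (circuit_exp k p), (circuit_exp p k).
      split; first by exists (k, p); rewrite ?mem_head.
        apply/mnmP => i; rewrite mnmDE mnmBE subnK // cE mulmnE mnm1E.
        by case: eqVneq => // <-; rewrite mul1n.
      by [].
    + by rewrite cE u'k.
    + by rewrite cE; move: su'; rewrite setD1K.
    + by rewrite cE du'.
    + by rewrite cE u'k.
  move=> u v su sv duv; case: (leqP (v k) (u k)) => [|/ltnW] le_k.
    exact: down.
  by apply/rst_sym/down.
- have degE (psi : 'I_n -> nat) i j :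
    A_deg psi (circuit_exp i j) = lcmn (a i) (a j) %/ a i * psi i.
    exact: A_degMU.
  move=> e; rewrite inE; case: eqVneq => [-> _|e_neq /= et'].
    (* The other circuits do not involve x_k. *)
    exists (fun i => (i == k) : nat); split.
      rewrite !degE /= eqxx (negPf pk) muln1 muln0.
      by move: (circuit_exp_gt0 k p); case: (_ %/ _).
    move=> e'; rewrite inE => /orP[/eqP-> /eqP//|/t'k[/negPf e'1 /negPf e'2] _].
    by rewrite !degE e'1 e'2 !muln0.
  have [psi [sep_e sep_t']] := t'_sep e et'.
  pose c := lcmn (a k) (a p) %/ a k; pose c' := lcmn (a p) (a k) %/ a p.
  (* The weight of x_k is forced by homogeneity of the new circuit; scaling the
     other weights by [c] keeps it integral. *)
  pose psi' i := if i == k then c' * psi p else c * psi i.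
  have psi'E i j : i != k ->
      A_deg psi' (circuit_exp i j) = c * A_deg psi (circuit_exp i j).
    by rewrite !degE /psi' => /negPf ->; rewrite mulnCA.
  exists psi'; split.
    have [e1 e2] := t'k _ et'; rewrite !psi'E // => /eqP.
    by rewrite eqn_pmul2l ?circuit_exp_gt0 // => /eqP.
  move=> e'; rewrite inE => /orP[/eqP-> _|e't' e'e] /=.
    by rewrite !degE /psi' eqxx (negPf pk) mulnCA.
  by have [e1 e2] := t'k _ e't'; rewrite !psi'E // sep_t'.
Qed.

End UniversallyFree.

(** * Ideals generated by binomials *)

Section Ideals.
Local Open Scope ring_scope.
Variable R : comNzRingType.
Implicit Types (B : R -> Prop) (f g : R).

Lemma ideal_gen_incl B f : B f -> ideal_gen B f.
Proof.
move=> Bf; exists [:: (1, f)]; last by rewrite big_seq1 mul1r.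
by move=> c; rewrite inE => /eqP ->.
Qed.

Lemma ideal_gen0 B : ideal_gen B 0.
Proof. by exists [::]; rewrite ?big_nil. Qed.

Lemma ideal_genD B f g : ideal_gen B f -> ideal_gen B g -> ideal_gen B (f + g).
Proof.
move=> [s sB ->] [t tB ->]; exists (s ++ t); last by rewrite big_cat.
by move=> c; rewrite mem_cat => /orP[/sB|/tB].
Qed.

Lemma ideal_genM B f g : ideal_gen B g -> ideal_gen B (f * g).
Proof.
move=> [s sB ->]; exists [seq (f * c.1, c.2) | c <- s].
  by move=> c /mapP[c' /sB Bc' ->].
by rewrite big_map mulr_sumr; apply: eq_bigr => c _; rewrite mulrA.
Qed.

Lemma ideal_gen_trans B B' f : (forall g, B g -> ideal_gen B' g) ->
  ideal_gen B f -> ideal_gen B' f.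
Proof.
move=> BB' [s sB ->]; elim: s => [|c s IH] in sB *.
  by rewrite big_nil; apply: ideal_gen0.
rewrite big_cons; apply: ideal_genD.
  by apply/ideal_genM/BB'/sB; rewrite mem_head.
by apply: IH => c' c's; apply: sB; rewrite inE c's orbT.
Qed.
End Ideals.

Section BinomialIdeals.
Local Open Scope ring_scope.
Variables (K : fieldType) (n : nat).
Implicit Types (f g : {mpoly K[n]}) (B : {mpoly K[n]} -> Prop)
  (u v w p q : 'X_{1..n}) (P : pred 'X_{1..n}).

(** For [P] a class of a congruence on monomials, this linear form kills all
    binomials compatible with the congruence, and their multiples. *)
Definition coef_sum P f : K := \sum_(m <- msupp f | P m) f@_m.

Lemma coef_sum_seq P f (s : seq 'X_{1..n}) :
  uniq s -> {subset msupp f <= s} -> coef_sum P f = \sum_(m <- s | P m) f@_m.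
Proof.
move=> uniq_s sub_s; rewrite /coef_sum [RHS](bigID [in msupp f]) /=.
rewrite [X in _ = _ + X]big1 ?addr0; last first.
  by move=> m /andP[_ /memN_msupp_eq0].
rewrite -[RHS]big_filter -[LHS]big_filter; apply: perm_big.
apply: uniq_perm; rewrite ?filter_uniq ?msupp_uniq // => m.
rewrite !mem_filter.
case: (boolP (m \in msupp f)) => [mf|]; last by rewrite !andbF.
by rewrite sub_s // !andbT.
Qed.

Lemma coef_sumD P f g : coef_sum P (f + g) = coef_sum P f + coef_sum P g.
Proof.
pose s := undup (msupp f ++ msupp g).
rewrite !(@coef_sum_seq P _ s) ?undup_uniq // => [|m|m|m].
- by rewrite -big_split; apply: eq_bigr => m _; rewrite mcoeffD.
- by rewrite mem_undup mem_cat orbC => ->.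
- by rewrite mem_undup mem_cat => ->.
- by move/msuppD_le; rewrite mem_undup.
Qed.

Lemma coef_sum0 P : coef_sum P 0 = 0.
Proof. by rewrite /coef_sum msupp0 big_nil. Qed.

Lemma coef_sumZX P (c : K) m : coef_sum P (c *: 'X_[m]) = c * (P m)%:R.
Proof.
rewrite (@coef_sum_seq P _ [:: m]) //.
  rewrite big_mkcond big_seq1 mcoeffZ mcoeffX eqxx mulr1.
  by case: (P m); rewrite ?mulr1 ?mulr0.
by move=> m' /msuppZ_le; rewrite msuppX.
Qed.

Lemma coef_sum_binom P (c : K) u v :
  coef_sum P (c *: binom K u v) = c * ((P u)%:R - (P v)%:R).
Proof. by rewrite scalerBr -scaleNr coef_sumD !coef_sumZX mulrBr mulNr. Qed.

Lemma coef_sumM_binom P g p q : (forall w, P (w + p)%MM = P (w + q)%MM) ->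
  coef_sum P (g * binom K p q) = 0.
Proof.
move=> Ppq; rewrite {1}[g]mpolyE mulr_suml.
rewrite (big_morph _ (coef_sumD P) (coef_sum0 P)) big1 // => m _.
have -> : g@_m *: 'X_[m] * binom K p q = g@_m *: binom K (m + p)%MM (m + q)%MM.
  by rewrite -scalerAl mulrBr -!mpolyXD.
by rewrite coef_sum_binom Ppq subrr mulr0.
Qed.

(** The sum of the coefficients on the connected component of [u] vanishes on
    the ideal, but not on x^u - x^v when [v] lies in another component. *)
Lemma ideal_gen_binom_connected B (G : 'X_{1..n} -> 'X_{1..n} -> Prop) u v :
    (forall f, B f -> exists p q, f = binom K p q /\ G p q) ->
    ideal_gen B (binom K u v) ->
  connected (monomial_moves G) u v.
Proof.
move=> BG [s sB Euv]; pose P m := `[< connected (monomial_moves G) u m >].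
have : coef_sum P (binom K u v) = 0.
  rewrite Euv (big_morph _ (coef_sumD P) (coef_sum0 P)) big_seq big1 // => c cs.
  have [p [q [-> Gpq]]] := BG _ (sB c cs); apply: coef_sumM_binom => w.
  have wpq : connected (monomial_moves G) (w + p)%MM (w + q)%MM.
    by apply: rst_step; exists w, p, q.
  by apply: asbool_equiv_eq; split=> uw; apply: rst_trans uw _; last apply: rst_sym.
rewrite -[binom K u v]scale1r coef_sum_binom mul1r.
have -> : P u by apply/asboolP/rst_refl.
case: (boolP (P v)) => [/asboolP//|_] /eqP.
by rewrite subr0 oner_eq0.
Qed.

Lemma connected_ideal_gen_binom B (G : 'X_{1..n} -> 'X_{1..n} -> Prop) u v :
    (forall p q, G p q -> ideal_gen B (binom K p q)) ->
    connected (monomial_moves G) u v ->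
  ideal_gen B (binom K u v).
Proof.
move=> GB; elim=> [x y [w [p [q [Gpq -> ->]]]]|x|x y _ IH|x y z _ IH1 _ IH2].
- have -> : binom K (w + p)%MM (w + q)%MM = 'X_[w] * binom K p q.
    by rewrite mulrBr -!mpolyXD.
  exact/ideal_genM/GB.
- by rewrite /binom subrr; apply: ideal_gen0.
- have -> : binom K y x = -1 * binom K x y by rewrite mulN1r opprB.
  exact: ideal_genM.
- have -> : binom K x z = binom K x y + binom K y z by rewrite addrA subrK.
  exact: ideal_genD.
Qed.

Lemma moves_A_deg (psi : 'I_n -> nat) (G : 'X_{1..n} -> 'X_{1..n} -> Prop) u v :
    (forall p q, G p q -> A_deg psi p = A_deg psi q) ->
  connected (monomial_moves G) u v -> A_deg psi u = A_deg psi v.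
Proof.
move=> Gpsi; elim=> [x y [w [p [q [/Gpsi dpq -> ->]]]]|//|//|x y z _ -> _ -> //].
by rewrite !A_degD dpq.
Qed.

(** The exponents are determined by the binomial only up to exchange in
    characteristic 2, and not at all for the zero binomial; homogeneity is
    nevertheless a property of the binomial. *)
Lemma binom_A_deg (psi : 'I_n -> nat) p q u v :
  binom K p q = binom K u v -> A_deg psi p = A_deg psi q ->
  A_deg psi u = A_deg psi v.
Proof.
move=> Epq dpq; apply: (@moves_A_deg _ (fun x y => x = p /\ y = q)).
  by move=> x y [-> ->].
apply: (@ideal_gen_binom_connected (eq (binom K p q))).
  by move=> f <-; exists p, q.
by rewrite -Epq; apply: ideal_gen_incl.
Qed.

Lemma binom_eq0 u v : (binom K u v == 0) = (u == v).
Proof.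
apply/eqP/eqP => [|->]; last by rewrite /binom subrr.
move/subr0_eq/(congr1 (mcoeff v)); rewrite !mcoeffX eqxx.
by case: eqVneq => // _ /esym/eqP; rewrite oner_eq0.
Qed.

Lemma binom_inj_or p q u v :
  u != v -> binom K p q = binom K u v -> u = p \/ u = q.
Proof.
move=> uv /(congr1 (mcoeff u)); rewrite !mcoeffB !mcoeffX eqxx.
rewrite [v == u]eq_sym (negPf uv) subr0.
case: (eqVneq p u) => [->|_]; first by left.
case: (eqVneq q u) => [->|_]; first by right.
by rewrite subr0 => /esym/eqP; rewrite oner_eq0.
Qed.

(** * Markov bases, Betti degrees and circuits *)

Section Toric.
Variable a : 'I_n -> nat.

Lemma toric_ideal_binom u v :
  toric_ideal a (binom K u v) <-> A_deg a u = A_deg a v.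
Proof.
split=> [|duv]; last by apply: ideal_gen_incl; exists u, v.
move=> /(@ideal_gen_binom_connected _ (fun p q => A_deg a p = A_deg a q)) con.
apply: moves_A_deg (con _) => // f [p [q [dpq ->]]].
by exists p, q.
Qed.

Lemma generates_toricP B : (forall f, B f -> toric_ideal a f) ->
  generates_toric a B <->
    (forall u v, A_deg a u = A_deg a v -> ideal_gen B (binom K u v)).
Proof.
move=> Btoric; split=> [gB u v /toric_ideal_binom /gB//|gB f].
split; first exact: ideal_gen_trans.
by apply: ideal_gen_trans => _ [u [v [/gB ? ->]]].
Qed.

Hypothesis a_gt0 : forall i, (0 < a i)%N.

Definition binom_pairs B p q : Prop := B (binom K p q).

Lemma toric_binom_pairs B p q : (forall f, B f -> toric_ideal a f) ->
  binom_pairs B p q -> A_deg a p = A_deg a q.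
Proof. by move=> Btoric /Btoric/toric_ideal_binom. Qed.

Lemma generates_toric_connected B u v :
    (forall f, B f -> toric_ideal a f /\ exists u v, f = binom K u v) ->
    generates_toric a B -> A_deg a u = A_deg a v ->
  connected (monomial_moves (binom_pairs B)) u v.
Proof.
move=> Bbin gB duv; apply: (@ideal_gen_binom_connected B).
  move=> f Bf; have [_ [p [q Ef]]] := Bbin f Bf.
  by exists p, q; rewrite /binom_pairs -Ef.
by apply/gB/toric_ideal_binom.
Qed.

(** If the monomials of an element of a Markov basis were connected, dividing
    each step by a shared variable would express this element by elements of
    smaller degree, against minimality. *)
Lemma betti_fiber_disconnected d :
  betti_degree K a d -> fiber_disconnected a [set: 'I_n] d.
Proof.
move=> [B [u [v [[Bbin gB Bmin] Buv du dv]]]].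
have Btoric f : B f -> toric_ideal a f by case/Bbin.
exists u, v; split; rewrite ?subsetT // => cuv.
(* The basis without the given element still generates the ideal. *)
pose C f := B f /\ f <> binom K u v.
have CB f : C f -> B f by case.
suff Cuv : ideal_gen C (binom K u v).
  suff gC : generates_toric a C by have [] := Bmin C CB gC _ Buv.
  apply/generates_toricP => [f /CB/Btoric//|x y /toric_ideal_binom/gB].
  apply: ideal_gen_trans => f Bf.
  have [->//|nf] := pselect (f = binom K u v).
  exact: ideal_gen_incl.
have [->|uv] := eqVneq u v; first by rewrite /binom subrr; apply: ideal_gen0.
have degB x y : connected (monomial_moves (binom_pairs B)) x y ->
    A_deg a x = A_deg a y.
  by apply: moves_A_deg => p q; apply: toric_binom_pairs.
have low x y : connected (monomial_moves (binom_pairs B)) x y ->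
    (A_deg a x < d)%N -> connected (monomial_moves (binom_pairs C)) x y.
  elim=> {x y} [x y [w [p [q [Bpq -> ->]]]]|x|x y /degB dxy IH|
      x y z /degB dxy IH1 _ IH2] x_lt.
  - apply: rst_step; exists w, p, q; split=> //; split=> // Epq.
    have dpq := toric_binom_pairs Btoric Bpq.
    case: (binom_inj_or uv Epq) => Eu; move: x_lt; rewrite A_degD.
      by rewrite -Eu du; lia.
    by rewrite dpq -Eu du; lia.
  - exact: rst_refl.
  - by apply/rst_sym/IH; rewrite dxy.
  - by apply: rst_trans (IH1 x_lt) (IH2 _); rewrite -dxy.
apply: (@connected_ideal_gen_binom _ (binom_pairs C)).
  by move=> p q; apply: ideal_gen_incl.
have step x y : shares_variable a [set: 'I_n] x y -> A_deg a x = d ->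
    connected (monomial_moves (binom_pairs C)) x y.
  move=> [_ _ dxy [i xi yi]] dx.
  have split_i (z : 'X_{1..n}) : z i != 0%N ->
      z = (U_(i) + (z - U_(i)))%MM /\ A_deg a z = (a i + A_deg a (z - U_(i))%MM)%N.
    move=> zi; have Ez : z = (U_(i) + (z - U_(i)))%MM.
      apply/mnmP => j; rewrite mnmDE mnmBE mnm1E subnKC //.
      by case: eqVneq => // <-; rewrite lt0n.
    split=> //; rewrite {1}Ez A_degD; congr (_ + _)%N.
    by have := A_degMU a i 1; rewrite mulm1n mul1n.
  have [Ex dx'] := split_i x xi; have [Ey dy'] := split_i y yi.
  rewrite Ex Ey; apply/moves_add/low; last by move: (a_gt0 i); lia.
  by apply: generates_toric_connected => //; apply/(@addnI (a i)); rewrite -dx' -dy'.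
have con x y : connected (shares_variable a [set: 'I_n]) x y ->
    A_deg a x = A_deg a y /\
    (A_deg a x = d -> connected (monomial_moves (binom_pairs C)) x y).
  elim=> {x y} [x y xy|x|x y _ [dxy IH]|x y z _ [dxy IH1] _ [dyz IH2]].
  - by case: (xy) => _ _ dxy _; split=> //; apply: step.
  - by split=> // _; apply: rst_refl.
  - by split=> // dy; apply/rst_sym/IH; rewrite dxy.
  - split=> [|dx]; first by rewrite dxy.
    by apply: rst_trans (IH1 dx) (IH2 _); rewrite -dxy.
by have [_] := con _ _ cuv; apply.
Qed.

(** A move by a generator of smaller degree has a nontrivial common factor, so
    only a generator of degree [d] can leave a component of the fiber. *)
Lemma fiber_disconnected_generator B d :
    (forall f, B f -> toric_ideal a f /\ exists u v, f = binom K u v) ->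
    generates_toric a B -> fiber_disconnected a [set: 'I_n] d ->
  exists p q, [/\ B (binom K p q), A_deg a p = d & A_deg a q = d].
Proof.
move=> Bbin gB [u [v [_ _ du dv nuv]]]; apply: contrapT => no_pq; apply: nuv.
have Btoric f : B f -> toric_ideal a f by case/Bbin.
have con x y : connected (monomial_moves (binom_pairs B)) x y ->
    A_deg a x = A_deg a y /\
    (A_deg a x = d -> connected (shares_variable a [set: 'I_n]) x y).
  elim=> {x y} [x y [w [p [q [Bpq -> ->]]]]|x|x y _ [dxy IH]|
      x y z _ [dxy IH1] _ [dyz IH2]].
  - have dpq := toric_binom_pairs Btoric Bpq; rewrite !A_degD dpq; split=> // dwq.
    apply: rst_step; split; rewrite ?subsetT ?A_degD ?dpq //.
    have [dw|dw] := eqVneq (A_deg a w) 0%N.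
      by case: no_pq; exists p, q; split; rewrite -?dwq ?dw ?dpq.
    have [i wi] := mnm_neq0 dw.
    by exists i; rewrite mnmDE addn_eq0 negb_and wi.
  - by split=> // _; apply: rst_refl.
  - by split=> // dy; apply/rst_sym/IH; rewrite dxy.
  - split=> [|dx]; first by rewrite dxy.
    by apply: rst_trans (IH1 dx) (IH2 _); rewrite -dxy.
have [_] := con _ _ (generates_toric_connected Bbin gB (etrans du (esym dv))).
exact.
Qed.

(** Two monomials of equal degree in a single variable are equal; hence the
    support of a nonzero binomial of the ideal has at least two elements. *)
Lemma circuit_binom i j : i != j ->
  circuit a (binom K (circuit_exp a i j) (circuit_exp a j i)).
Proof.
move=> ij; set u := circuit_exp a i j; set v := circuit_exp a j i.
have uE k : u k = ((i == k) * (lcmn (a i) (a j) %/ a i))%N by rewrite mulmnE mnm1E.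
have vE k : v k = ((j == k) * (lcmn (a j) (a i) %/ a j))%N by rewrite mulmnE mnm1E.
have supp_u : supp u = [set i].
  apply/setP => k; rewrite !inE uE [k == i]eq_sym.
  case: (eqVneq i k) => [_|_]; last by rewrite mul0n.
  by rewrite mul1n -lt0n circuit_exp_gt0.
have supp_v : supp v = [set j].
  apply/setP => k; rewrite !inE vE [k == j]eq_sym.
  case: (eqVneq j k) => [_|_]; last by rewrite mul0n.
  by rewrite mul1n -lt0n circuit_exp_gt0.
exists u, v; split=> //.
  split.
  - by apply/toric_ideal_binom; rewrite !A_deg_circuit_exp lcmnC.
  - by rewrite supp_u supp_v disjoints1 inE.
  - set g := \big[_/_]_(_ < _) _.
    have gi : (g %| a j %/ gcdn (a i) (a j))%N.
      rewrite (_ : _ %/ _ = u i + v i)%N; first exact: (biggcdn_inf i).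
      rewrite uE vE eqxx eq_sym (negPf ij) mul1n addn0.
      by rewrite /lcmn -muln_divA ?dvdn_gcdr // mulKn.
    have gj : (g %| a i %/ gcdn (a i) (a j))%N.
      rewrite (_ : _ %/ _ = u j + v j)%N; first exact: (biggcdn_inf j).
      rewrite uE vE eqxx (negPf ij) mul1n /= mul0n add0n.
      by rewrite /lcmn gcdnC -muln_divA ?dvdn_gcdr // mulKn.
    have gcd_gt0 : (0 < gcdn (a i) (a j))%N by rewrite gcdn_gt0 a_gt0.
    apply/eqP; rewrite -dvdn1.
    rewrite -(dvdn_pmul2r gcd_gt0) mul1n dvdn_gcd.
    by rewrite -!dvdn_divRL ?dvdn_gcdl ?dvdn_gcdr // gi gj.
move=> u' v' /toric_ideal_binom duv'; rewrite binom_eq0 => uv' sub_ij.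
apply/eqP; rewrite eqEsubset sub_ij /=.
move: sub_ij; rewrite supp_u supp_v subUset => /andP[su' sv'].
have both k l : supp u' \subset k |: [set l] -> supp v' \subset k |: [set l] ->
    k \in supp u' :|: supp v'.
  move=> su sv; apply: contraT; rewrite !inE negb_or !negbK.
  move=> /andP[/eqP u'k /eqP v'k].
  case/eqP: uv'; apply: (@mnm_sub1_inj _ _ a_gt0 l) => //.
    apply/supp_subP => m; rewrite inE => ml; have [->//|mk] := eqVneq m k.
    by move/supp_subP: su; apply; rewrite !inE negb_or mk.
  apply/supp_subP => m; rewrite inE => ml; have [->//|mk] := eqVneq m k.
  by move/supp_subP: sv; apply; rewrite !inE negb_or mk.
by rewrite subUset !sub1set (both i j) ?(both j i) // setUC.
Qed.

End Toric.
End BinomialIdeals.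

(** Minimality: if the circuit [b e] were missing, all the moves available
    would preserve the weight that detects [e]. *)
Lemma circuit_markov_basis (K : fieldType) n (a : 'I_n -> nat) :
    (0 < n)%N -> (forall i, (0 < a i)%N) -> free_on_subsets a ->
  exists s : seq {mpoly K[n]},
    [/\ uniq s, size s = (n - 1)%N, forall f, f \in s -> circuit a f &
        markov_basis a (fun f => f \in s)].
Proof.
move=> n_gt0 a_gt0 a_free.
have n_neq0 : [set: 'I_n] != set0 by rewrite -card_gt0 cardsT card_ord.
have [t [uniq_t size_t tJ t_gen t_sep]] := circuit_system a_gt0 a_free n_neq0.
pose b (e : 'I_n * 'I_n) :=
  binom K (circuit_exp a e.1 e.2) (circuit_exp a e.2 e.1).
have circ_t f : f \in [seq b e | e <- t] -> circuit a f.
  by case/mapP => e /tJ[e12 _ _] ->; apply: circuit_binom.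
have bin_t f : f \in [seq b e | e <- t] ->
    toric_ideal a f /\ exists u v, f = binom K u v.
  by case/circ_t => u [v [-> [tor _ _] _]]; split=> //; exists u, v.
have b_inj : {in t &, injective b}.
  move=> e e' et e't be; apply/eqP; apply: contraT => e_neq.
  have [psi [sep_e same]] := t_sep e et; case: sep_e.
  by apply: (binom_A_deg (esym be)); apply: same; rewrite // eq_sym.
exists [seq b e | e <- t]; split=> //; first by rewrite map_inj_in_uniq.
  by rewrite size_map size_t cardsT card_ord subn1.
split=> //.
  apply/generates_toricP => [f /bin_t[]//|u v duv].
  apply: (@connected_ideal_gen_binom _ _ _ (circuit_pairs a t)).
    move=> p q [e et [-> ->]]; apply: ideal_gen_incl.
    by apply/mapP; exists e.
  by apply: t_gen; rewrite ?subsetT.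
move=> C Ct gC _ /mapP[e et ->]; apply: contrapT => nCe.
have [psi [sep_e same]] := t_sep e et; case: sep_e.
apply: (@moves_A_deg _ psi (binom_pairs C)); last first.
  apply: generates_toric_connected gC _ => [f /Ct/bin_t//|].
  by rewrite !A_deg_circuit_exp lcmnC.
move=> p q Cpq; have /mapP[e' e't Epq] := Ct _ Cpq.
apply: (binom_A_deg (esym Epq)); apply: same => //.
by apply: contra_notN nCe => /eqP <-; rewrite -Epq.
Qed.

(** The converse direction needs some Markov basis to exist, and the circuits
    provide one. *)
Lemma betti_degreeP (K : fieldType) n (a : 'I_n -> nat) d :
    (0 < n)%N -> (forall i, (0 < a i)%N) -> free_on_subsets a ->
  betti_degree K a d <-> fiber_disconnected a [set: 'I_n] d.
Proof.
move=> n_gt0 a_gt0 a_free; split; first exact: betti_fiber_disconnected.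
have [s [_ _ _ s_markov]] := circuit_markov_basis K n_gt0 a_gt0 a_free.
have [bin_s gen_s _] := s_markov.
case/(fiber_disconnected_generator bin_s gen_s) => p [q [spq dp dq]].
by exists (fun f => f \in s), p, q.
Qed.

Lemma numerical_semigroup_gcd n (S : nat -> Prop) (a : 'I_n -> nat) :
  numerical_semigroup S -> generates S a [set: 'I_n] ->
  gcd_of a [set: 'I_n] = 1%N.
Proof.
move=> [k [g [_ g1 gS]]] aS; apply/eqP; rewrite -dvdn1 -g1.
apply/dvdn_biggcdP => i _; apply: in_gen_dvd; apply/aS/gS.
exists (fun j => j == i : nat); rewrite (bigD1 i) ?inE //= eqxx mul1n big1 ?addn0 //.
by move=> j /andP[_ /negPf ->].
Qed.

Lemma lcm_gcd_others n (a : 'I_n -> nat) i :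
  gcd_of a [set: 'I_n] = 1%N ->
  lcmn (a i) (gcd_of a [set~ i]) = (gcd_of a [set~ i] * a i)%N.
Proof.
move=> gcd1; rewrite mulnC -muln_lcm_gcd.
suff -> : gcdn (a i) (gcd_of a [set~ i]) = 1%N by rewrite muln1.
rewrite -gcd1 [in RHS]/gcd_of (bigD1 i) ?inE //=.
by congr gcdn; apply: eq_bigl => j; rewrite !inE.
Qed.

(** The gcd of the other generators divides c * a_i and is prime to a_i, hence
    divides c; by freeness it is itself an admissible multiplier. *)
Lemma least_multiplier_gcd n (a : 'I_n -> nat) i c :
    (0 < a i)%N -> (0 < gcd_of a [set~ i])%N -> gcd_of a [set: 'I_n] = 1%N ->
    in_gen a [set~ i] (lcmn (a i) (gcd_of a [set~ i])) ->
  is_least_multiplier a i c -> c = gcd_of a [set~ i].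
Proof.
move=> ai_gt0 g_gt0 gcd1; rewrite lcm_gcd_others // => g_gen [c_gt0 c_gen c_min].
apply/eqP; rewrite eqn_leq c_min //= dvdn_leq //.
rewrite -(dvdn_pmul2r ai_gt0) -lcm_gcd_others // dvdn_lcm dvdn_mull //=.
exact: in_gen_dvd.
Qed.

Theorem proposition3p10 (K : fieldType) (n : nat) (n_ge2 : 2 <= n)
    (S : nat -> Prop) (a : 'I_n -> nat) (c : 'I_n -> nat)
    (S_numerical : numerical_semigroup S)
    (a_minimal : minimal_generating_set S a)
    (c_least : forall i : 'I_n, is_least_multiplier a i (c i))
    (S_univ_free : universally_free a) :
  [/\ (forall i : 'I_n, c i = gcd_of a [set~ i]),
      (forall d : nat, betti_degree K a d ->
         exists k : 'I_n, c k * a k %| d),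
      (exists s : seq {mpoly K[n]},
         [/\ uniq s, size s = n - 1,
             (forall f, f \in s -> circuit a f) &
             markov_basis a (fun f : {mpoly K[n]} => f \in s)]) &
      (forall d : nat, betti_degree K a d <->
         exists i j : 'I_n, i != j /\ d = lcmn (a i) (a j))].
Proof.
have n_gt0 : 0 < n by apply: ltnW.
have [_ a_gt0 aS _] := a_minimal.
have a_free := universally_free_on_subsets S_univ_free.
have gcd1 := numerical_semigroup_gcd S_numerical aS.
have C_neq0 (i : 'I_n) : [set~ i] != set0.
  by have := cardsC [set i]; rewrite cards1 card_ord -card_gt0; lia.
have C_gt0 i : 0 < gcd_of a [set~ i] by apply: gcd_of_gt0.
have i_free i : in_gen a [set~ i] (lcmn (a i) (gcd_of a [set~ i])).
  by apply: a_free; rewrite ?inE ?eqxx.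
have c_gcd i : c i = gcd_of a [set~ i] by apply: least_multiplier_gcd.
split=> //.
- move=> d /(betti_degreeP _ _ n_gt0 a_gt0 a_free) dT.
  have [k _] := fiber_disconnected_dvd_lcm_gcd a_gt0 a_free dT.
  by rewrite setTD lcm_gcd_others // -c_gcd; exists k.
- exact: circuit_markov_basis.
- move=> d; apply: (iff_trans (betti_degreeP _ _ n_gt0 a_gt0 a_free)); split.
    case/(fiber_disconnected_lcm a_gt0 a_free) => i [j [_ _ ij ->]].
    by exists i, j.
  by move=> [i [j [ij ->]]]; apply: lcm_fiber_disconnected; rewrite ?inE.
Qed.
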